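(* Let $x=(p_1,\dots,p_N)\in\mathbb R^{N\times 3}$ be a point cloud and $\|x\|_2=(\sum_i\|p_i\|_2^2)^{1/2}$. Let $\sigma>0$, let $\epsilon\in\mathbb R^{N\times3}$ have i.i.d. $\mathcal N(0,\sigma^2)$ entries, and $q(y\mid x';\epsilon)=\mathbb E_\epsilon[P(y\mid x'+\epsilon)]$ for a base classifier $P$. Let $0<R\le\pi$, $\eta\ge0$, $\delta\ge0$ with $\frac{\delta^2}{4}+\frac{\eta^2R^2}{8}\le 1$. Let $z_j=(k_j,\theta_j)$, $j=1,\dots,M$, with $k_j\in S^2$, $\theta_j\in[0,R]$, such that for every $k\in S^2$ and $\theta\in[0,R]$ there is a $j$ with $\angle(k,k_j)\le\eta$ and $|\theta-\theta_j|\le\delta$. Suppose $y_A\in\mathcal Y$ and $p_A^{(j)},p_B^{(j)}\in(0,1)$ satisfy for all $j$ $$q(y_A\mid\phi_R(x,z_j);\epsilon)\ge p_A^{(j)}>p_B^{(j)}\ge\max_{y\ne y_A}q(y\mid\phi_R(x,z_j);\epsilon)$$ and $$\frac{\sigma}{2}\Big(\Phi^{-1}(p_A^{(j)})-\Phi^{-1}(p_B^{(j)})\Big)>\pi\sqrt{\frac{\delta^2}{4}+\frac{\eta^2R^2}{8}}\;\|x\|_2 .$$ Then for every $k\in S^2$, $\theta\in[0,R]$ and $y\ne y_A$: $q(y_A\mid\phi_R(x,(k,\theta));\epsilon)>q(y\mid\phi_R(x,(k,\theta));\epsilon)$.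
   Context: The general rotation with parameter $(k,\theta)\in S^2\times\mathbb R_{\ge0}$ acts pointwise by $\phi_R(p_i,(k,\theta))=Rot(k,\theta)p_i$, where $Rot(k,\theta)\in SO(3)$ is the rotation by angle $\theta$ about the unit axis $k$. $\angle(k,k_j)\in[0,\pi]$ denotes the angle between unit vectors $k,k_j$. Labels $\mathcal Y=\{1,\dots,C\}$; a base classifier is a measurable map $x\mapsto P(\cdot\mid x)$ to probability vectors on $\mathcal Y$. $\Phi$ is the standard normal CDF. *)

(* Defs.v *)
From HB Require Import structures.
From mathcomp Require Import all_boot all_order all_algebra.
From mathcomp Require Import all_classical all_reals all_analysis.

Set Implicit Arguments.
Unset Strict Implicit.
Unset Printing Implicit Defensive.

Import Order.TTheory GRing.Theory Num.Theory.
Local Open Scope classical_set_scope.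
Local Open Scope ring_scope.

Section Defs.
Variable R : realType.

(* Iterated Gaussian expectation over R^n: each of the n coordinates is an
   independent N(0, s^2) variable (normal_prob 0 s has standard deviation s).
   gauss_exp s n f = E[f(e_1,...,e_n)], computed as an iterated Lebesgue
   integral (equal to the product-measure integral by Tonelli for the
   nonnegative measurable integrands used below). *)
Fixpoint gauss_exp (s : R) (n : nat) : (n.-tuple R -> \bar R) -> \bar R :=
  match n return (n.-tuple R -> \bar R) -> \bar R with
  | 0 => fun f => f [tuple]
  | n'.+1 => fun f =>
      (\int[normal_prob 0 s]_t gauss_exp s (fun u : n'.-tuple R => f [tuple of t :: u]))%E
  end.

Definition tuple_to_cloud (N : nat) (t : (N * 3).-tuple R) : 'M[R]_(N, 3) :=
  vec_mx (\row_i tnth t i).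

Definition is_base_classifier (N C : nat) (P : 'M[R]_(N, 3) -> 'I_C -> R) : Prop :=
  (forall y, measurable_fun [set: (N * 3).-tuple R]
               (fun t => P (tuple_to_cloud t) y)) /\
  (forall x y, 0 <= P x y) /\
  (forall x, \sum_(y < C) P x y = 1).

Definition smoothed (N C : nat) (sigma : R) (P : 'M[R]_(N, 3) -> 'I_C -> R)
    (x' : 'M[R]_(N, 3)) (y : 'I_C) : R :=
  fine (gauss_exp sigma (fun t : (N * 3).-tuple R => (P (x' + tuple_to_cloud t) y)%:E)).

Definition cloud_norm (N : nat) (x : 'M[R]_(N, 3)) : R :=
  Num.sqrt (\sum_(i < N) \sum_(j < 3) x i j ^+ 2).

Definition dot3 (u v : 'rV[R]_3) : R := \sum_(i < 3) u 0 i * v 0 i.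

Definition on_S2 (k : 'rV[R]_3) : Prop := dot3 k k = 1.

Definition vangle (k k' : 'rV[R]_3) : R := acos (dot3 k k').

Definition crossmx (k : 'rV[R]_3) : 'M[R]_3 :=
  \matrix_(i < 3, j < 3)
    (if (val i == 0%N) && (val j == 1%N) then - k 0 (inord 2)
     else if (val i == 0%N) && (val j == 2%N) then k 0 (inord 1)
     else if (val i == 1%N) && (val j == 0%N) then k 0 (inord 2)
     else if (val i == 1%N) && (val j == 2%N) then - k 0 (inord 0)
     else if (val i == 2%N) && (val j == 0%N) then - k 0 (inord 1)
     else if (val i == 2%N) && (val j == 1%N) then k 0 (inord 0)
     else 0).

(* Rot(k, theta): rotation by angle theta about the unit axis k (Rodrigues). *)
Definition Rot (k : 'rV[R]_3) (theta : R) : 'M[R]_3 :=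
  1%:M + sin theta *: crossmx k + (1 - cos theta) *: (crossmx k *m crossmx k).

(* phi_R(x, (k, theta)): each point p_i (row i of x) is mapped to Rot p_i;
   with points stored as rows this is x *m Rot^T. *)
Definition phiR (N : nat) (x : 'M[R]_(N, 3)) (k : 'rV[R]_3) (theta : R) : 'M[R]_(N, 3) :=
  x *m (Rot k theta)^T.

Definition Phi (t : R) : R := fine (normal_prob 0 1 [set u : R | u <= t]).
Definition Phi_inv (p : R) : R := xget 0 [set t : R | Phi t = p].

End Defs.

(* Main.v *)
Require Import Defs.
From HB Require Import structures.
From mathcomp Require Import all_boot all_order all_algebra.
From mathcomp Require Import all_classical all_reals all_analysis.
From mathcomp Require Import measurable_realfun ring lra.
Import Order.TTheory GRing.Theory Num.Theory.
Import numFieldNormedType.Exports.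
Local Open Scope classical_set_scope.
Local Open Scope ring_scope.

(** Writing rotations as unit quaternions [q], two rotations displace a point
    [p] by at most [2 |q - q'| |p|], and [|q - q'|^2] is at most
    [delta^2/4 + eta^2 Rad^2/4]; since [8 <= pi^2] this bounds the distance
    between the rotated clouds by the [r] on the right of the margin condition.
    By Neyman-Pearson, shifting a [0,1]-valued function by a vector of norm at
    most [r] lowers the inverse normal CDF of its Gaussian mean by at most
    [r / sigma], half-spaces being extremal. If [y] had at least the score of
    [yA] at the rotation considered, moving from the net point to it for [yA]
    and back for [y] would give [y] a score above [pB] at the net point. *)

(** * Distance between rotations *)

(** By the mean value theorem on [[0, x]] and [|cos| <= 1]; oddness of [sin] covers negative
    arguments. *)
Lemma normrsin_le {R : realType} (t : R) : `|sin t| <= `|t|.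
Proof.
have [->|t0] := eqVneq t 0; first by rewrite sin0.
suff H (x : R) : 0 < x -> `|sin x| <= x.
  have [tp|tn] : 0 < t \/ t < 0 by move: t0; rewrite neq_lt orbC => /orP.
    by rewrite (gtr0_norm tp) H.
  by rewrite -normrN -sinN (ltr0_norm tn) H// oppr_gt0.
move=> x0.
have [|y yx] := @MVT R sin cos 0 x x0 (fun y _ => is_derive_sin y).
  by apply: continuous_subspaceT => z; exact: continuous_sin.
rewrite sin0 !subr0 => ->.
by rewrite normrM (gtr0_norm x0) ger_pMl// cos_max.
Qed.

(** Half-angle form: [cos t] is [1 - 2 sin^2 (t / 2)], and [|sin (t / 2)| <= |t / 2|]. *)
Lemma cos_ge_quadratic {R : realType} (t : R) : 1 - t ^+ 2 / 2 <= cos t.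
Proof.
have -> : t = (t / 2) *+ 2 by rewrite -mulr_natr; field.
rewrite cos_mulr2n cos2sin2.
have := normrsin_le (t / 2); rewrite -ler_sqr ?nnegrE// !real_normK ?num_real//.
rewrite -(mulr_natr (t / 2)) -mulr_natr => H.
nra.
Qed.

(** Equivalent to [sqrt 2 <= pi / 2], which follows from [cos (sqrt 2) > 0]. *)
Lemma pi_sqr_ge8 {R : realType} : 8 <= (pi : R) ^+ 2.
Proof.
pose q : R := Num.sqrt 2.
have q2 : q ^+ 2 = 2 by rewrite sqr_sqrtr.
have q0 : 0 <= q by exact: sqrtr_ge0.
have cq : 0 < cos q.
  (* At [q] itself the quadratic bound only gives [cos q >= 0]; at [q / 2] it gives [3 / 4], and
     doubling the angle gives [cos q >= 1 / 8]. *)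
  have -> : q = (q / 2) *+ 2 by rewrite -mulr_natr; field.
  have := cos_ge_quadratic (q / 2); rewrite cos_mulr2n expr_div_n q2 -mulr_natr.
  by move=> H; nra.
have qpi : q <= pi / 2.
  rewrite leNgt; apply/negP => lt.
  have p2 := @pi_ge2 R.
  have : cos q < cos (pi / 2).
    rewrite ltr_cos// in_itv /=; apply/andP; split=> //; nra.
  by rewrite cos_pihalf ltNge ltW.
have p0 := @pi_ge0 R.
nra.
Qed.

Section rotation.
Context {R : realType}.
Implicit Types (k : 'rV[R]_3) (th : R).

Lemma sum3E (F : 'I_3 -> R) :
  \sum_i F i = F (inord 0) + F (inord 1) + F (inord 2).
Proof.
rewrite !big_ord_recl big_ord0 addr0 addrA.
by congr (F _ + F _ + F _); apply: val_inj; rewrite /= inordK.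
Qed.

Lemma crossmxE k (i j : nat) : (i < 3)%N -> (j < 3)%N ->
  crossmx k (inord i) (inord j) =
  if (i == 0%N) && (j == 1%N) then - k 0 (inord 2)
  else if (i == 0%N) && (j == 2%N) then k 0 (inord 1)
  else if (i == 1%N) && (j == 0%N) then k 0 (inord 2)
  else if (i == 1%N) && (j == 2%N) then - k 0 (inord 0)
  else if (i == 2%N) && (j == 0%N) then - k 0 (inord 1)
  else if (i == 2%N) && (j == 1%N) then k 0 (inord 0)
  else 0.
Proof. by move=> i3 j3; rewrite mxE /= (inordK i3) (inordK j3). Qed.

Lemma RotE k th (i j : nat) : (i < 3)%N -> (j < 3)%N ->
  Rot k th (inord i) (inord j) = (i == j)%:R +
    sin th * crossmx k (inord i) (inord j) + (1 - cos th) *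
    (crossmx k (inord i) (inord 0) * crossmx k (inord 0) (inord j) +
     crossmx k (inord i) (inord 1) * crossmx k (inord 1) (inord j) +
     crossmx k (inord i) (inord 2) * crossmx k (inord 2) (inord j)).
Proof.
move=> i3 j3; rewrite /Rot; move: (crossmx k) => B.
by rewrite !mxE sum3E -val_eqE /= (inordK i3) (inordK j3).
Qed.

(** Rodrigues' formula with [K^2 p = (k . p) k - p], where [c^2 - s^2 = cos th], [2 c s = sin th]
    and [2 s^2 = 1 - cos th]. The half-angle form is conjugation by the unit quaternion
    [(c, s k)]. *)
Lemma phiRE (N : nat) (x : 'M[R]_(N, 3)) k th i :
  let p l := x i (inord l) in let v l := k 0 (inord l) in
  let s := sin (th / 2) in let c := cos (th / 2) in
  let kp := v 0%N * p 0%N + v 1%N * p 1%N + v 2%N * p 2%N in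
  on_S2 k ->
  [/\ phiR x k th i (inord 0) = (c ^+ 2 - s ^+ 2) * p 0%N +
      2 * c * s * (v 1%N * p 2%N - v 2%N * p 1%N) + 2 * s ^+ 2 * kp * v 0%N,
      phiR x k th i (inord 1) = (c ^+ 2 - s ^+ 2) * p 1%N +
      2 * c * s * (v 2%N * p 0%N - v 0%N * p 2%N) + 2 * s ^+ 2 * kp * v 1%N &
      phiR x k th i (inord 2) = (c ^+ 2 - s ^+ 2) * p 2%N +
      2 * c * s * (v 0%N * p 1%N - v 1%N * p 0%N) + 2 * s ^+ 2 * kp * v 2%N].
Proof.
move=> p v s c kp; rewrite /on_S2 /dot3 sum3E -/(v 0%N) -/(v 1%N) -/(v 2%N) => vv.
have thE : th = (th / 2) *+ 2 by rewrite -mulr_natr; field.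
have sE : sin th = 2 * c * s by rewrite {1}thE sin_mulr2n -mulr_natr /c /s; ring.
have cE : cos th = 1 - 2 * s ^+ 2.
  by rewrite {1}thE cos_mulr2n cos2sin2 -mulr_natr /s; ring.
have c2 : c ^+ 2 = 1 - s ^+ 2 by rewrite /c cos2sin2.
(* Unit length as a rewriting rule for [ring] below. *)
have v0 : v 0%N * v 0%N = 1 - v 1%N * v 1%N - v 2%N * v 2%N by rewrite -vv; ring.
have E j : (j < 3)%N -> phiR x k th i (inord j) =
    p 0%N * Rot k th (inord j) (inord 0) + p 1%N * Rot k th (inord j) (inord 1)
    + p 2%N * Rot k th (inord j) (inord 2).
  by move=> j3; rewrite /phiR mxE sum3E !mxE.
rewrite !E// !RotE// !crossmxE//= -/(v 0%N) -/(v 1%N) -/(v 2%N) sE cE c2 /kp.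
split; ring: v0.
Qed.

Lemma normr_sin_half_le (Rad th : R) : 0 <= th <= Rad -> `|sin (th / 2)| <= Rad / 2.
Proof.
move=> /andP[th0 thR]; apply: (le_trans (normrsin_le _)).
by rewrite ger0_norm ?divr_ge0// ler_pM2r// invr_gt0.
Qed.

(* The local [q] computes one coordinate of the conjugate of [p] by the
   quaternion [(c, v)]; [C] and [w] are the scalar and vector parts of
   [conj (c', v') * (c, v)]. For unit quaternions, [C] is the cosine of half the
   angle of the relative rotation. *)
Lemma quaternion_rotation_dist (p0 p1 p2 c v0 v1 v2 c' v0' v1' v2' : R) :
  let q a u0 u1 u2 x0 x1 x2 u :=
    (a ^+ 2 - (u0 ^+ 2 + u1 ^+ 2 + u2 ^+ 2)) * x0 + 2 * a * (u1 * x2 - u2 * x1) +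
    2 * (u0 * x0 + u1 * x1 + u2 * x2) * u in
  let P := p0 ^+ 2 + p1 ^+ 2 + p2 ^+ 2 in
  let C := c * c' + v0 * v0' + v1 * v1' + v2 * v2' in
  let n := c ^+ 2 + v0 ^+ 2 + v1 ^+ 2 + v2 ^+ 2 in
  let n' := c' ^+ 2 + v0' ^+ 2 + v1' ^+ 2 + v2' ^+ 2 in
  let w0 := c' * v0 - c * v0' - (v1' * v2 - v2' * v1) in
  let w1 := c' * v1 - c * v1' - (v2' * v0 - v0' * v2) in
  let w2 := c' * v2 - c * v2' - (v0' * v1 - v1' * v0) in
  (q c v0 v1 v2 p0 p1 p2 v0 - q c' v0' v1' v2' p0 p1 p2 v0') ^+ 2 +
  (q c v1 v2 v0 p1 p2 p0 v1 - q c' v1' v2' v0' p1 p2 p0 v1') ^+ 2 +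
  (q c v2 v0 v1 p2 p0 p1 v2 - q c' v2' v0' v1' p2 p0 p1 v2') ^+ 2 =
  (n - n') ^+ 2 * P +
  4 * ((n * n' - C ^+ 2) * P - (w0 * p0 + w1 * p1 + w2 * p2) ^+ 2).
Proof. by cbv beta zeta; ring. Qed.

(** From [|k + k'|^2 >= 0] and [|k - k'|^2 >= 0]; it places the dot product where [cos] inverts
    [acos]. *)
Lemma dot3_bound (k k' : 'rV[R]_3) : on_S2 k -> on_S2 k' -> -1 <= dot3 k k' <= 1.
Proof.
rewrite /on_S2 /dot3 !sum3E => kk kk'.
have := sqr_ge0 (k 0 (inord 0) + k' 0 (inord 0)).
have := sqr_ge0 (k 0 (inord 1) + k' 0 (inord 1)).
have := sqr_ge0 (k 0 (inord 2) + k' 0 (inord 2)).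
have := sqr_ge0 (k 0 (inord 0) - k' 0 (inord 0)).
have := sqr_ge0 (k 0 (inord 1) - k' 0 (inord 1)).
have := sqr_ge0 (k 0 (inord 2) - k' 0 (inord 2)).
by move=> *; apply/andP; split; nra.
Qed.

Lemma dot3_vangle_ge (k k' : 'rV[R]_3) (eta : R) : on_S2 k -> on_S2 k' ->
  vangle k k' <= eta -> 1 - dot3 k k' <= eta ^+ 2 / 2.
Proof.
move=> kS kS'; have b := dot3_bound _ _ kS kS'.
have a0 := acos_ge0 b; rewrite /vangle => ae.
rewrite -{1}(@acosK R (dot3 k k')); last by rewrite in_itv.
have := cos_ge_quadratic (acos (dot3 k k')).
nra.
Qed.

(** [C] is the inner product of the unit quaternions [q], [q'] of the two rotations, so
    [8 (1 - C) = 4 |q - q'|^2]. The quaternion identity bounds the squared displacement of [p] by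
    [4 (1 - C^2) |p|^2]. *)
Lemma phiR_row_dist (N : nat) (x : 'M[R]_(N, 3)) k k' th th' C i :
  on_S2 k -> on_S2 k' ->
  C = cos ((th - th') / 2) - sin (th / 2) * sin (th' / 2) * (1 - dot3 k k') ->
  \sum_j ((phiR x k th - phiR x k' th') i j) ^+ 2 <= 8 * (1 - C) * \sum_j (x i j) ^+ 2.
Proof.
move=> kS kS' CE.
have [e0 e1 e2] := phiRE _ x _ th i kS; have [e0' e1' e2'] := phiRE _ x _ th' i kS'.
move: kS kS'; rewrite /on_S2 /dot3 !sum3E => kS kS'.
have sc := cos2Dsin2 (th / 2); have sc' := cos2Dsin2 (th' / 2).
(* The cosine of a difference turns [C] into the inner product of [(c, s k)] and [(c', s' k')]. *)
have {}CE : C = cos (th / 2) * cos (th' / 2) + sin (th / 2) * sin (th' / 2) *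
    (k 0 (inord 0) * k' 0 (inord 0) + k 0 (inord 1) * k' 0 (inord 1) +
     k 0 (inord 2) * k' 0 (inord 2)).
  by rewrite CE mulrBl cosB /dot3 sum3E; ring.
have D (A B : 'M[R]_(N, 3)) j : (A - B) i j = A i j - B i j by rewrite !mxE.
rewrite !D e0 e1 e2 e0' e1' e2' {D e0 e1 e2 e0' e1' e2'}.
move: kS kS' sc sc' CE.
set s := sin (th / 2); set c := cos (th / 2).
set s' := sin (th' / 2); set c' := cos (th' / 2).
set k0 := k 0 (inord 0); set k1 := k 0 (inord 1); set k2 := k 0 (inord 2).
set k0' := k' 0 (inord 0); set k1' := k' 0 (inord 1); set k2' := k' 0 (inord 2).
set p0 := x i (inord 0); set p1 := x i (inord 1); set p2 := x i (inord 2).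
move=> kS kS' sc sc' CE.
have := @quaternion_rotation_dist p0 p1 p2 c (s * k0) (s * k1) (s * k2)
  c' (s' * k0') (s' * k1') (s' * k2').
cbv beta zeta.
set w := (X in _ - X ^+ 2).
have n1 : c ^+ 2 + (s * k0) ^+ 2 + (s * k1) ^+ 2 + (s * k2) ^+ 2 = 1.
  by rewrite -sc -[s ^+ 2]mulr1 -kS; ring.
have n1' : c' ^+ 2 + (s' * k0') ^+ 2 + (s' * k1') ^+ 2 + (s' * k2') ^+ 2 = 1.
  by rewrite -sc' -[s' ^+ 2]mulr1 -kS'; ring.
rewrite n1 n1' subrr expr0n mul0r add0r mulr1.
have v1 : (s * k0) ^+ 2 + (s * k1) ^+ 2 + (s * k2) ^+ 2 = s ^+ 2.
  by rewrite -[RHS]mulr1 -kS; ring.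
have v1' : (s' * k0') ^+ 2 + (s' * k1') ^+ 2 + (s' * k2') ^+ 2 = s' ^+ 2.
  by rewrite -[RHS]mulr1 -kS'; ring.
have v2 : (s * k1) ^+ 2 + (s * k2) ^+ 2 + (s * k0) ^+ 2 = s ^+ 2 by rewrite -v1; ring.
have v2' : (s' * k1') ^+ 2 + (s' * k2') ^+ 2 + (s' * k0') ^+ 2 = s' ^+ 2.
  by rewrite -v1'; ring.
have v3 : (s * k2) ^+ 2 + (s * k0) ^+ 2 + (s * k1) ^+ 2 = s ^+ 2 by rewrite -v1; ring.
have v3' : (s' * k2') ^+ 2 + (s' * k0') ^+ 2 + (s' * k1') ^+ 2 = s' ^+ 2.
  by rewrite -v1'; ring.
rewrite v1 v1' v2 v2' v3 v3'.
have -> : c * c' + s * k0 * (s' * k0') + s * k1 * (s' * k1') + s * k2 * (s' * k2') = C.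
  by rewrite CE; ring.
move=> E.
apply: (@le_trans _ _ (4 * ((1 - C ^+ 2) * (p0 ^+ 2 + p1 ^+ 2 + p2 ^+ 2) - w ^+ 2))).
  by rewrite -E le_eqVlt; apply/orP; left; apply/eqP; ring.
have w0 := sqr_ge0 w.
have P0 : 0 <= p0 ^+ 2 + p1 ^+ 2 + p2 ^+ 2 by rewrite !addr_ge0 ?sqr_ge0.
have C0 := mulr_ge0 (sqr_ge0 (1 - C)) P0.
set P := p0 ^+ 2 + p1 ^+ 2 + p2 ^+ 2 in P0 C0 *.
(* The surplus of [8 (1 - C)] over [4 (1 - C^2)] is [4 (1 - C)^2], a nonnegative term. *)
have -> : 8 * (1 - C) * P = 4 * ((1 - C ^+ 2) * P) + 4 * ((1 - C) ^+ 2 * P) by ring.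
by rewrite mulrBr; lra.
Qed.

Lemma phiR_dist (N : nat) (x : 'M[R]_(N, 3)) k k' th th' (Rad eta delta : R) :
  on_S2 k -> on_S2 k' -> 0 <= th <= Rad -> 0 <= th' <= Rad ->
  vangle k k' <= eta -> `|th - th'| <= delta ->
  cloud_norm (phiR x k th - phiR x k' th') <=
  pi * Num.sqrt (delta ^+ 2 / 4 + eta ^+ 2 * Rad ^+ 2 / 8) * cloud_norm x.
Proof.
move=> kS kS' thR thR' ke td.
pose C := cos ((th - th') / 2) - sin (th / 2) * sin (th' / 2) * (1 - dot3 k k').
pose B := delta ^+ 2 / 4 + eta ^+ 2 * Rad ^+ 2 / 8.
have d1 := dot3_vangle_ge _ _ _ kS kS' ke.
have /andP[_ d0] := dot3_bound _ _ kS kS'.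
have Rad0 : 0 <= Rad by case/andP: thR => ? ?; lra.
have td2 : (th - th') ^+ 2 <= delta ^+ 2.
  by rewrite -(real_normK (num_real (th - th'))) lerXn2r ?nnegrE// (le_trans _ td).
have ss : sin (th / 2) * sin (th' / 2) <= Rad ^+ 2 / 4.
  apply: (le_trans (ler_norm _)); rewrite normrM.
  have -> : Rad ^+ 2 / 4 = (Rad / 2) * (Rad / 2) by field.
  by rewrite ler_pM// normr_sin_half_le.
(* The angles contribute [(delta / 2)^2 / 2], the axes [(Rad / 2)^2 * (eta^2 / 2)]. *)
have C1 : 1 - C <= delta ^+ 2 / 8 + Rad ^+ 2 * eta ^+ 2 / 8.
  have c1 := cos_ge_quadratic ((th - th') / 2).
  have c2 : (1 - dot3 k k') * (sin (th / 2) * sin (th' / 2)) <=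
            (eta ^+ 2 / 2) * (Rad ^+ 2 / 4).
    apply: (@le_trans _ _ ((1 - dot3 k k') * (Rad ^+ 2 / 4))).
      by rewrite ler_wpM2l// subr_ge0.
    by rewrite ler_wpM2r// divr_ge0// sqr_ge0.
  rewrite /C; move: c1 c2 td2; rewrite expr_div_n.
  set u := sin _ * sin _; set d := dot3 k k'; nra.
have B0 : 0 <= B.
  have := sqr_ge0 delta; have := mulr_ge0 (sqr_ge0 eta) (sqr_ge0 Rad).
  by rewrite /B; lra.
(* [8 * B] is [2 delta^2 + eta^2 Rad^2]: the axis term matches the bound on [8 (1 - C)] exactly, the
   angle term has a factor 2 to spare. *)
have CB : 8 * (1 - C) <= pi ^+ 2 * B.
  apply: (@le_trans _ _ (8 * B)); last by rewrite ler_wpM2r// pi_sqr_ge8.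
  have := sqr_ge0 delta; move: C1; rewrite /B; lra.
have piE : pi = Num.sqrt (pi ^+ 2) :> R by rewrite sqrtr_sqr ger0_norm ?pi_ge0.
have piB0 : 0 <= (pi : R) ^+ 2 * B by rewrite mulr_ge0 ?sqr_ge0.
rewrite /cloud_norm -/B {1}piE -(sqrtrM _ (sqr_ge0 _)) -(sqrtrM _ piB0).
rewrite ler_wsqrtr// mulr_sumr; apply: ler_sum => i _.
apply: (le_trans (phiR_row_dist _ x _ _ _ _ C i kS kS' erefl)).
by rewrite ler_wpM2r// sumr_ge0// => j _; exact: sqr_ge0.
Qed.

End rotation.

(** * One-dimensional Gaussian integrals *)

(** Lebesgue measure is [|a|] times its pushforward under [x -> a x + b]: the two agree on half-open
    intervals, hence everywhere by uniqueness. *)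
Lemma ge0_integral_affine {R : realType} (a b : R) (f : R -> \bar R) :
  a != 0 -> measurable_fun setT f -> (forall x, 0 <= f x)%E ->
  (\int[lebesgue_measure]_x f x =
   `|a|%:E * \int[lebesgue_measure]_x f (a * x + b)%R)%E.
Proof.
move=> a0 mf f0.
pose phi : measurableTypeR R -> measurableTypeR R := fun x => a * x + b.
have mphi : measurable_fun setT phi.
  by apply: measurable_funD => //; exact: measurable_funM.
pose nu : {measure set (measurableTypeR R) -> \bar R} :=
  mscale (NngNum (normr_ge0 a)) (pushforward lebesgue_measure phi).
have nuE A : measurable A -> lebesgue_measure A = nu mphi A.
  apply: lebesgue_measure_unique => _ [[x y] _ <-].
  rewrite /nu /= /mscale /= /pushforward.
  have [agt|alt] : 0 < a \/ a < 0 by move: a0; rewrite neq_lt orbC => /orP.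
  - have -> : phi @^-1` `]x, y] = `](x - b) / a, (y - b) / a]%classic.
      by apply/seteqP; split=> z /=; rewrite !in_itv /= ltr_pdivrMr// ler_pdivlMr// /phi;
        rewrite ltrBlDr lerBrDr (mulrC z).
    rewrite !lebesgue_measure_itv /= !lte_fin ltr_pM2r ?invr_gt0// ltrD2r.
    case: ifP; rewrite ?mule0// => _.
    by rewrite -!EFinB -EFinM gtr0_norm//; congr (_%:E); field; rewrite gt_eqF.
  (* A negative slope reverses the interval: the preimage is closed on the left and open on the
     right, with the same length formula up to sign. *)
  - have -> : phi @^-1` `]x, y] = `[(y - b) / a, (x - b) / a[%classic.
      by apply/seteqP; split=> z /=; rewrite !in_itv /= ltr_ndivlMr// ler_ndivrMr// /phi;
        rewrite ltrBlDr lerBrDr (mulrC z) andbC.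
    rewrite !lebesgue_measure_itv /= !lte_fin ltr_nM2r ?invr_lt0// ltrD2r.
    case: ifP; rewrite ?mule0// => _.
    by rewrite -!EFinB -EFinM ltr0_norm//; congr (_%:E); field; rewrite lt_eqF.
transitivity (\int[nu mphi]_x f x)%E.
  by apply: eq_measure_integral => A mA _; exact: nuE.
rewrite /nu ge0_integral_mscale//=; congr (_ * _)%E.
by rewrite ge0_integral_pushforward.
Qed.

(** The Radon-Nikodym derivative and the density have the same integral over every measurable set,
    so they agree almost everywhere. *)
Lemma ge0_integral_normal_prob {R : realType} (s : R) (f : R -> \bar R) :
  measurable_fun setT f -> (forall x, 0 <= f x)%E ->
  (\int[normal_prob 0 s]_x f x =
   \int[lebesgue_measure]_x (f x * (normal_pdf 0 s x)%:E))%E.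
Proof.
move=> mf f0.
have dom := normal_prob_dominates 0 s.
rewrite -(Radon_Nikodym_SigmaFinite.change_of_variables dom)//.
have mpdf : measurable_fun setT (fun x : R => (normal_pdf 0 s x)%:E).
  by apply/measurable_EFinP; exact: measurable_normal_pdf.
have int := Radon_Nikodym_SigmaFinite.f_integrable dom.
apply: ae_eq_integral => //.
- by apply: emeasurable_funM => //; exact: measurable_int int.
- by apply: emeasurable_funM.
- apply: ae_eqe_mul2l; apply: integral_ae_eq => //= E _ mE.
  by rewrite -Radon_Nikodym_SigmaFinite.f_integral.
Qed.

Lemma measurable_fun_integral_normal_prob {R : realType} {d : measure_display}
    {T : measurableType d} (s : R) (f : T * R -> \bar R) :
  measurable_fun setT f -> (forall z, 0 <= f z)%E ->
  measurable_fun setT (fun x => (\int[normal_prob 0 s]_y f (x, y))%E).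
Proof.
exact: (@measurable_fun_fubini_tonelli_F _ _ T (measurableTypeR R) R (normal_prob 0 s) f).
Qed.

Lemma normal_pdfM_rot {R : realType} (s x y x' y' : R) : s != 0 ->
  x ^+ 2 + y ^+ 2 = x' ^+ 2 + y' ^+ 2 ->
  normal_pdf 0 s x * normal_pdf 0 s y = normal_pdf 0 s x' * normal_pdf 0 s y'.
Proof.
move=> s0 e; rewrite !normal_pdfE// /normal_fun !subr0.
rewrite mulrACA [RHS]mulrACA -!expRD; congr (_ * expR _).
by rewrite -!mulrDl -!opprD e.
Qed.

Lemma measurable_affine2 {R : realType} (a b : R) :
  measurable_fun [set: R * R] (fun z => a * z.1 + b * z.2).
Proof.
by apply: measurable_funD; apply: measurable_funM => //.
Qed.

(* The substitution [y = (r z - a x) / b] is a planar rotation of [(x, y)], so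
   it preserves the product of the densities. *)
Lemma ge0_integral_normal_prob_lin2 {R : realType} (s a b r : R) (phi : R -> \bar R) :
  s != 0 -> 0 <= r -> r ^+ 2 = a ^+ 2 + b ^+ 2 ->
  measurable_fun setT phi -> (forall x, 0 <= phi x)%E ->
  (\int[normal_prob 0 s]_x \int[normal_prob 0 s]_y phi (a * x + b * y)%R =
   \int[normal_prob 0 s]_z phi (r * z)%R)%E.
Proof.
move=> s0 r0 r2 mphi phi0.
set g := normal_prob 0 s; set rho := normal_pdf 0 s.
have rho0 x : 0 <= rho x by exact: normal_pdf_ge0.
have mrho : measurable_fun setT rho by exact: measurable_normal_pdf.
have mlin (u v : R) : measurable_fun setT (fun y => u + v * y).
  by apply: measurable_funD => //; exact: measurable_funM.
have mpl (u v : R) : measurable_fun setT (fun y => phi (u + v * y)).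
  by apply: measurableT_comp mphi _; exact: mlin.
have [b0|b0] := eqVneq b 0.
  have -> : (\int[g]_x \int[g]_y phi (a * x + b * y)%R = \int[g]_x phi (a * x)%R)%E.
    apply: eq_integral => x _.
    transitivity (\int[g]_y cst (phi (a * x)%R) y)%E.
      by apply: eq_integral => y _; rewrite b0 mul0r addr0.
    rewrite integral_cst//; rewrite -[RHS]mule1; congr (_ * _)%E; exact: probability_setT.
  have mm (u : R) : measurable_fun setT (fun x => phi (u * x)).
    by apply: measurableT_comp mphi _; exact: measurable_funM.
  have /orP[/eqP->//|/eqP ra] : (r == a) || (r == - a).
    by rewrite -eqf_sqr r2 b0 expr0n addr0.
  rewrite !ge0_integral_normal_prob//.
  (* Here [r = - a]; reflecting [x] to [- x] leaves the centred density unchanged. *)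
  rewrite (@ge0_integral_affine R (-1) 0)//; last 2 first.
  - by apply: emeasurable_funM; [exact: mm | exact/measurable_EFinP].
  - by move=> x; apply: mule_ge0; rewrite // lee_fin; exact: rho0.
  rewrite normrN1 mul1e; apply: eq_integral => x _.
  rewrite addr0 mulN1r mulrN ra -mulNr; congr (_ * _%:E)%E.
  by rewrite /rho !normal_pdfE// /normal_fun !subr0 sqrrN.
have rn0 : r != 0.
  by rewrite -sqrf_eq0 r2 paddr_eq0 ?sqr_ge0// !sqrf_eq0 (negbTE b0) andbF.
pose k := r / b; have k0 : k != 0 by rewrite mulf_neq0 ?invr_eq0.
(* The integrand in [(x, z)] after substituting [y = k z - a x / b], with Jacobian [|k|]. *)
pose H (w : R * R) : \bar R :=
  (phi (r * w.2)%R * (`|k| * (rho (k * w.2 - a * w.1 / b) * rho w.1))%:E)%E.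
have H0 w : (0 <= H w)%E by rewrite mule_ge0// lee_fin !mulr_ge0.
have mk : measurable_fun [set: R * R] (fun w => k * w.2 - a * w.1 / b).
  by apply: measurable_funB; repeat apply: measurable_funM => //.
have mH : measurable_fun setT H.
  apply: emeasurable_funM.
    by apply: measurableT_comp mphi _; exact: measurable_funM.
  apply/measurable_EFinP; apply: measurable_funM => //; apply: measurable_funM.
    by apply: measurableT_comp mrho mk.
  by apply: measurableT_comp mrho _.
transitivity (\int[lebesgue_measure]_x \int[lebesgue_measure]_z H (x, z))%E.
  rewrite ge0_integral_normal_prob//; last 2 first.
  - apply: (@measurable_fun_integral_normal_prob R _ _ s (fun w => phi (a * w.1 + b * w.2))) => //.
    by apply: measurableT_comp mphi _; exact: measurable_affine2.
  - by move=> x; exact: integral_ge0.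
  apply: eq_integral => x _.
  have m1 : measurable_fun [set: R] (fun y => phi (a * x + b * y)%R * (rho y)%:E)%E.
    by apply: emeasurable_funM => //; exact/measurable_EFinP.
  rewrite ge0_integral_normal_prob//.
  rewrite (@ge0_integral_affine R k (- (a * x / b)))//; last first.
    by move=> y; rewrite mule_ge0// lee_fin.
  have m2 : measurable_fun [set: R]
      (fun y => phi (a * x + b * (k * y + - (a * x / b)))%R *
                (rho (k * y + - (a * x / b))%R)%:E)%E.
    by apply: (measurableT_comp m1); apply: measurable_funD => //; exact: measurable_funM.
  rewrite -ge0_integralZl//; last by move=> y _; rewrite mule_ge0// lee_fin.
  rewrite -ge0_integralZr//; [|by apply: emeasurable_funM => //; exact: m2| | ].
  2: by move=> y _; rewrite !mule_ge0// lee_fin.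
  2: by rewrite lee_fin.
  apply: eq_integral => y _.
  rewrite /H /= muleCA -!muleA -!EFinM; congr (phi _ * _)%E.
  by rewrite /k; field.
transitivity (\int[lebesgue_measure]_z \int[lebesgue_measure]_x H (x, z))%E.
  exact: (@fubini_tonelli _ _ (measurableTypeR R) (measurableTypeR R) R
    lebesgue_measure lebesgue_measure H).
rewrite ge0_integral_normal_prob//; last first.
  by apply: measurableT_comp mphi _; exact: measurable_funM.
apply: eq_integral => z _.
rewrite /H /=.
(* The pairs [((r z - a x) / b, x)] and [(z, (r x - a z) / b)] have equal norm, so the factor
   [rho z] separates from [x]. *)
have E x : (`|k| * (rho (k * z - a * x / b) * rho x))%:E =
   ((rho z)%:E * (`|k|%:E * (rho (k * x + - (a * z / b)))%:E))%E.
  rewrite -!EFinM; congr _%:E.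
  rewrite [X in `|k| * X](@normal_pdfM_rot _ s _ _ z (k * x - a * z / b))//.
    by rewrite mulrCA.
  have -> : k * z - a * x / b = (r * z - a * x) / b by rewrite /k; field.
  have -> : k * x - a * z / b = (r * x - a * z) / b by rewrite /k; field.
  have B : b ^+ 2 = r ^+ 2 - a ^+ 2 by rewrite r2 addrC addKr.
  have B0 : r ^+ 2 - a ^+ 2 != 0 by rewrite -B sqrf_eq0.
  rewrite !expr_div_n B; field.
  exact: B0.
under eq_integral do rewrite E.
have mr : measurable_fun [set: R] (fun x => (rho (k * x + - (a * z / b)))%:E).
  apply/measurable_EFinP; apply: measurableT_comp mrho _.
  by apply: measurable_funD => //; exact: measurable_funM.
have r0' x : (0 <= (rho (k * x + - (a * z / b)))%:E)%E by rewrite lee_fin.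
rewrite ge0_integralZl; [|by []|by do 2 apply: emeasurable_funM => //| |by []]; last first.
  by move=> x _; rewrite !mule_ge0// lee_fin.
rewrite ge0_integralZl; [|by []|by apply: emeasurable_funM => //| |by rewrite lee_fin]; last first.
  by move=> x _; rewrite !mule_ge0// lee_fin.
rewrite ge0_integralZl//.
(* What remains over [x] is the density after an affine change of variable, of total mass 1. *)
rewrite -(@ge0_integral_affine R k (- (a * z / b)) (fun x => (rho x)%:E));
  [|by []|exact/measurable_EFinP|by move=> x; rewrite lee_fin].
by rewrite integral_normal_pdf mule1.
Qed.

(** * The normal distribution function *)

Lemma Phi_fin {R : realType} (t : R) :
  (Phi t)%:E = normal_prob 0 1 [set u : R | u <= t].
Proof. by rewrite /Phi fineK// fin_num_measure// -set_itvNyc. Qed.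

Lemma PhiB {R : realType} (a b : R) : a <= b ->
  (Phi b - Phi a)%:E = normal_prob 0 1 [set` `]a, b] ].
Proof.
move=> ab; have E : (normal_prob 0 1 [set u : R | (u <= b)%R] =
    normal_prob 0 1 [set u : R | (u <= a)%R] + normal_prob 0 1 [set` `]a, b] ])%E.
  rewrite -measureU//.
  - congr (normal_prob _ _ _); apply/seteqP; split=> u /=; rewrite in_itv /=.
      by move=> ub; have [ua|au] := leP u a; [left | right; rewrite ub].
    by case=> [ua|/andP[]//]; exact: le_trans ab.
  - by rewrite -set_itvNyc.
  - apply/seteqP; split=> u //= [] ua; rewrite in_itv /= => /andP[au _].
    by move: au; rewrite ltNge ua.
by rewrite EFinB !Phi_fin E addeAC subee ?add0e// fin_num_measure// -set_itvNyc.
Qed.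

Lemma Phi_lt {R : realType} (a b : R) : a < b -> Phi a < Phi b.
Proof.
move=> ab.
(* The density at [|a| + |b|], a positive lower bound for it on []a, b]]. *)
pose m := normal_peak (1 : R) * expR (- (`|a| + `|b|) ^+ 2 / (1 ^+ 2 *+ 2)).
have m0 : 0 < m by rewrite mulr_gt0 ?expR_gt0// normal_peak_gt0// oner_neq0.
rewrite -subr_gt0 -lte_fin PhiB ?ltW//.
apply: (@lt_le_trans _ _ (\int[lebesgue_measure]_(x in `]a, b]) m%:E)%E).
  rewrite integral_cst//= lebesgue_measure_itv/= lte_fin ab -EFinD -EFinM lte_fin.
  by rewrite mulr_gt0// subr_gt0.
apply: ge0_le_integral => //.
- by move=> x _; rewrite lee_fin ltW.
- by apply: measurable_funTS; apply/measurable_EFinP; exact: measurable_normal_pdf.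
- move=> x /=; rewrite in_itv/= => /andP[ax xb]; rewrite lee_fin.
  rewrite normal_pdfE ?oner_neq0// /m /normal_fun ler_wpM2l ?normal_peak_ge0//.
  rewrite ler_expR ler_pM2r; last by rewrite invr_gt0 expr1n.
  rewrite lerN2 subr0 -real_normK ?num_real// ler_sqr ?nnegrE ?addr_ge0//.
  rewrite ler_norml; apply/andP; split.
    by have := ler_norm (- a); rewrite normrN; have := normr_ge0 b; lra.
  by have := ler_norm b; have := normr_ge0 a; lra.
Qed.

(** The density never exceeds its peak. *)
Lemma Phi_lipschitz {R : realType} (a b : R) : a <= b ->
  Phi b - Phi a <= normal_peak 1 * (b - a).
Proof.
move=> ab; rewrite -lee_fin PhiB//.
apply: (@le_trans _ _ (\int[lebesgue_measure]_(x in `]a, b]) (normal_peak 1)%:E)%E).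
  apply: ge0_le_integral => //.
  - by move=> x _; rewrite lee_fin normal_pdf_ge0.
  - by apply: measurable_funTS; apply/measurable_EFinP; exact: measurable_normal_pdf.
  - by move=> x _; rewrite lee_fin normal_pdf_ub// oner_neq0.
rewrite integral_cst//= lebesgue_measure_itv/= lte_fin.
case: ltP => _; first by rewrite -EFinD -EFinM.
by rewrite mule0 lee_fin mulr_ge0 ?normal_peak_ge0// subr_ge0.
Qed.

Lemma continuous_Phi {R : realType} : continuous (@Phi R).
Proof.
move=> x; apply/cvgrPdist_le => e e0.
have K0 : 0 < normal_peak (1 : R) by rewrite normal_peak_gt0// oner_neq0.
near=> y.
have d : `|x - y| <= e / normal_peak 1.
  by near: y; apply: cvgr_dist_le; [exact: cvg_id | exact: divr_gt0].
apply: (@le_trans _ _ (normal_peak 1 * `|x - y|)); last first.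
  by rewrite mulrC -ler_pdivlMr.
have [xy|yx] := leP x y.
  rewrite distrC (distrC x) (ger0_norm (x := y - x)) ?subr_ge0//.
  rewrite ger0_norm ?Phi_lipschitz// subr_ge0.
  by move: xy; rewrite le_eqVlt => /orP[/eqP->//|/Phi_lt/ltW].
rewrite (gtr0_norm (x := x - y)) ?subr_gt0// gtr0_norm ?Phi_lipschitz ?ltW//.
by rewrite subr_gt0 Phi_lt.
Unshelve. all: by end_near. Qed.

Lemma Phi_surj {R : realType} (p : R) : 0 < p < 1 -> exists t, Phi t = p.
Proof.
move=> /andP[p0 p1].
pose Q : probability (measurableTypeR R) R := normal_prob 0 1.
have mid : measurable_fun setT (idfun : measurableTypeR R -> R) by exact: measurable_id.
(* The identity has law [Q], so its [cdf] is [Phi] and the limits 0 and 1 of a [cdf] apply; the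
   intermediate value theorem then concludes. *)
pose X : {RV Q >-> R} := HB.pack (idfun : measurableTypeR R -> R)
  (isMeasurableFun.Build _ _ _ _ _ mid).
have PhiE t : Phi t = fine (@cdf _ _ R Q X t).
  by rewrite /Phi /cdf -set_itvNyc.
have [y py] : exists y, p < Phi y.
  have : \forall y \near +oo%R, p < Phi y.
    have /fine_cvg := @cvg_cdfy1 _ _ R Q X.
    move=> /cvgr_gt /(_ _ p1); apply: filterS => y /=.
    by rewrite PhiE.
  exact: filter_ex.
have [x px] : exists x, Phi x < p.
  have : \forall x \near -oo%R, Phi x < p.
    have /fine_cvg := @cvg_cdfNy0 _ _ R Q X.
    move=> /cvgr_lt /(_ _ p0); apply: filterS => x /=.
    by rewrite PhiE.
  exact: filter_ex.
have xy : x <= y.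
  by rewrite leNgt; apply/negP => /Phi_lt; lra.
have [||t _ <-] := @IVT R (@Phi R) x y p xy; last by exists t.
  by apply: continuous_subspaceT => z; exact: continuous_Phi.
by rewrite ge_min le_max (ltW px) (ltW py) orbT.
Qed.

(** By surjectivity, [xget] returns a solution and not its default [0]. *)
Lemma Phi_invK {R : realType} (p : R) : 0 < p < 1 -> Phi (Phi_inv p) = p.
Proof. by move=> /Phi_surj[t pt]; exact: (xgetPex 0 (ex_intro [set t | Phi t = p] t pt)). Qed.

(** * Gaussian expectation over tuples *)

Lemma gauss_exp_ge0 {R : realType} (s : R) n (f : n.-tuple R -> \bar R) :
  (forall t, 0 <= f t)%E -> (0 <= gauss_exp s f)%E.
Proof.
elim: n f => [|n IH] f f0 //=.
by apply: integral_ge0 => x _; exact: IH.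
Qed.

(** The parameter space [T] is arbitrary because the induction moves the first coordinate into it,
    replacing [T] by [T * R]. *)
Lemma measurable_gauss_exp {R : realType} {d : measure_display}
    {T : measurableType d} (s : R) n (f : T * n.-tuple R -> \bar R) :
  measurable_fun setT f -> (forall z, 0 <= f z)%E ->
  measurable_fun setT (fun x => gauss_exp s (fun u => f (x, u))).
Proof.
elim: n d T f => [|n IH] d T f mf f0 /=.
  by apply: measurableT_comp mf _; exact: measurable_fun_pair.
pose g (z : (T * R) * n.-tuple R) := f (z.1.1, [tuple of z.1.2 :: z.2]).
have mg : measurable_fun setT g.
  apply: measurableT_comp mf _; apply: measurable_fun_pair.
    exact: measurableT_comp.
  by apply: measurable_cons => //; exact: measurableT_comp.
apply: (@measurable_fun_integral_normal_prob R _ _ s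
  (fun z => gauss_exp s (fun u => f (z.1, [tuple of z.2 :: u])))).
  have := IH _ (T * R)%type g mg (fun z => f0 _).
  by [].
by move=> z; exact: gauss_exp_ge0.
Qed.

Section cons_section.
Context {R : realType} {n : nat} {f : n.+1.-tuple R -> \bar R}.
Hypothesis mf : measurable_fun setT f.

Lemma measurable_cons_uncurry :
  measurable_fun setT (fun z : R * n.-tuple R => f [tuple of z.1 :: z.2]).
Proof. by apply: measurableT_comp mf _; exact: measurable_cons. Qed.

Lemma measurable_cons_curry (t : R) :
  measurable_fun setT (fun u : n.-tuple R => f [tuple of t :: u]).
Proof. by apply: measurableT_comp mf _; exact: measurable_cons. Qed.

Lemma measurable_gauss_exp_cons (s : R) : (forall t, 0 <= f t)%E ->
  measurable_fun setT (fun t => gauss_exp s (fun u => f [tuple of t :: u])).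
Proof.
move=> f0; exact: (@measurable_gauss_exp R _ _ s n
  (fun z : R * n.-tuple R => f [tuple of z.1 :: z.2])
  measurable_cons_uncurry (fun z => f0 _)).
Qed.

End cons_section.

Section gauss_exp_theory.
Context {R : realType} (s : R).
Implicit Types n : nat.

Lemma le_gauss_exp n (f g : n.-tuple R -> \bar R) :
  measurable_fun setT f -> measurable_fun setT g ->
  (forall t, 0 <= f t)%E -> (forall t, f t <= g t)%E ->
  (gauss_exp s f <= gauss_exp s g)%E.
Proof.
elim: n f g => [|n IH] f g mf mg f0 fg //=.
have g0 t : (0 <= g t)%E by exact: le_trans (f0 t) (fg t).
apply: ge0_le_integral => //.
- by move=> t _; exact: gauss_exp_ge0.
- exact: measurable_gauss_exp_cons.
- exact: measurable_gauss_exp_cons.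
- by move=> t _; apply: IH => //; exact: measurable_cons_curry.
Qed.

Lemma gauss_expD n (f g : n.-tuple R -> \bar R) :
  measurable_fun setT f -> measurable_fun setT g ->
  (forall t, 0 <= f t)%E -> (forall t, 0 <= g t)%E ->
  gauss_exp s (fun t => f t + g t)%E = (gauss_exp s f + gauss_exp s g)%E.
Proof.
elim: n f g => [|n IH] f g mf mg f0 g0 //=.
rewrite -ge0_integralD//.
- apply: eq_integral => t _.
  by rewrite -IH//; exact: measurable_cons_curry.
- by move=> t _; exact: gauss_exp_ge0.
- exact: measurable_gauss_exp_cons.
- by move=> t _; exact: gauss_exp_ge0.
- exact: measurable_gauss_exp_cons.
Qed.

Lemma gauss_expZl n (k : R) (f : n.-tuple R -> \bar R) : 0 <= k ->
  measurable_fun setT f -> (forall t, 0 <= f t)%E ->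
  gauss_exp s (fun t => k%:E * f t)%E = (k%:E * gauss_exp s f)%E.
Proof.
move=> k0; elim: n f => [|n IH] f mf f0 //=.
rewrite -ge0_integralZl//.
- apply: eq_integral => t _.
  by rewrite -IH//; exact: measurable_cons_curry.
- exact: measurable_gauss_exp_cons.
- by move=> t _; exact: gauss_exp_ge0.
Qed.

Lemma gauss_exp1 n : gauss_exp s (fun _ : n.-tuple R => 1%E) = 1%E.
Proof.
elim: n => [|n IH] //=; rewrite IH integral_cst// mul1e; exact: probability_setT.
Qed.

End gauss_exp_theory.

(** The shift is a function on indices, so that its tail is composition with [lift ord0]. *)
Definition tshift {R : realType} {n} (a : 'I_n -> R) (t : n.-tuple R) : n.-tuple R :=
  [tuple a i + tnth t i | i < n].

Lemma tshift_cons {R : realType} n (a : 'I_n.+1 -> R) (t : R) (u : n.-tuple R) :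
  tshift a [tuple of t :: u] =
  [tuple of a ord0 + t :: tshift (fun i => a (lift ord0 i)) u].
Proof.
apply: eq_from_tnth => i; rewrite tnth_mktuple.
case: (unliftP ord0 i) => [j|] ->; last by [].
by rewrite !tnthS tnth_mktuple.
Qed.

Lemma measurable_tshift {R : realType} n (a : 'I_n -> R) : measurable_fun setT (tshift a).
Proof.
apply/measurable_fun_tnthP => i.
rewrite (_ : _ \o _ = (fun t => a i + tnth t i)); last first.
  by apply/funext => t /=; rewrite tnth_mktuple.
by apply: measurable_funD => //; exact: measurable_tnth.
Qed.

Lemma measurable_dot {R : realType} n (a : 'I_n -> R) :
  measurable_fun setT (fun t : n.-tuple R => \sum_i a i * tnth t i).
Proof.
apply: measurable_sum => i; apply: measurable_funM => //; exact: measurable_tnth.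
Qed.

(** * Shifts and linear functionals of a Gaussian vector *)

Section gauss_exp_linear.
Context {R : realType} (s : R).
Hypothesis s0 : s != 0.

(** The exponential is the likelihood ratio of [N(a, s^2)] to [N(0, s^2)]; the substitution
    [x -> x + a] cancels it against the density. *)
Lemma ge0_integral_normal_prob_shift (a : R) (f : R -> \bar R) :
  measurable_fun setT f -> (forall x, 0 <= f x)%E ->
  (\int[normal_prob 0 s]_x f (a + x)%R =
   \int[normal_prob 0 s]_x (f x * (expR ((a * x - a ^+ 2 / 2) / s ^+ 2))%:E))%E.
Proof.
move=> mf f0.
have me : measurable_fun setT (fun x : R => (expR ((a * x - a ^+ 2 / 2) / s ^+ 2))%:E).
  apply/measurable_EFinP; apply: measurableT_comp => //.
  apply: measurable_funM => //; apply: measurable_funB => //; exact: measurable_funM.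
have mr : measurable_fun setT (fun x : R => (normal_pdf 0 s x)%:E).
  by apply/measurable_EFinP; exact: measurable_normal_pdf.
rewrite ge0_integral_normal_prob//; last first.
  by apply: measurableT_comp mf _; exact: measurable_funD.
rewrite ge0_integral_normal_prob; last 2 first.
- exact: emeasurable_funM.
- by move=> x; rewrite mule_ge0// lee_fin expR_ge0.
rewrite [RHS](@ge0_integral_affine R 1 a); last 3 first.
- exact: oner_neq0.
- by do 2 apply: emeasurable_funM => //.
- by move=> x; rewrite !mule_ge0// lee_fin ?expR_ge0 ?normal_pdf_ge0.
rewrite normr1 mul1e; apply: eq_integral => x _.
rewrite mul1r (addrC x) -muleA -EFinM; congr (_ * _%:E)%E.
rewrite !normal_pdfE// /normal_fun !subr0 mulrCA -expRD; congr (_ * expR _).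
by rewrite -mulr_natr; field.
Qed.

Lemma measurable_likelihood n (a : 'I_n -> R) :
  measurable_fun setT (fun t : n.-tuple R =>
    (expR ((\sum_i a i * tnth t i - (\sum_i a i ^+ 2) / 2) / s ^+ 2))%:E).
Proof.
apply/measurable_EFinP; apply: measurableT_comp => //.
apply: measurable_funM => //; apply: measurable_funB => //; exact: measurable_dot.
Qed.

(** The Cameron-Martin formula: the likelihood ratio is a product over coordinates, peeled off one
    at a time. *)
Lemma gauss_exp_shift n (a : 'I_n -> R) (f : n.-tuple R -> \bar R) :
  measurable_fun setT f -> (forall t, 0 <= f t)%E ->
  gauss_exp s (fun t => f (tshift a t)) =
  gauss_exp s (fun t => f t *
    (expR ((\sum_i a i * tnth t i - (\sum_i a i ^+ 2) / 2) / s ^+ 2))%:E)%E.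
Proof.
elim: n a f => [|n IH] a f mf f0.
  rewrite /= !big_ord0 mul0r subr0 mul0r expR0 mule1; congr f.
  exact: tuple0.
pose a' i := a (lift ord0 i).
pose L' (u : n.-tuple R) :=
  (expR ((\sum_i a' i * tnth u i - (\sum_i a' i ^+ 2) / 2) / s ^+ 2))%:E.
(* All coordinates but the first are integrated out, with the likelihood ratio of the tail. *)
pose F t := gauss_exp s (fun u => f [tuple of t :: u] * L' u)%E.
have mL' : measurable_fun setT L' by exact: measurable_likelihood.
have L'0 u : (0 <= L' u)%E by rewrite lee_fin expR_ge0.
have F0 t : (0 <= F t)%E.
  by apply: gauss_exp_ge0 => u; rewrite mule_ge0.
have mF : measurable_fun setT F.
  apply: (@measurable_gauss_exp R _ _ s n
    (fun z : R * n.-tuple R => f [tuple of z.1 :: z.2] * L' z.2)%E).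
    apply: emeasurable_funM; first exact: measurable_cons_uncurry.
    exact: measurableT_comp mL' _.
  by move=> z; rewrite mule_ge0.
transitivity (\int[normal_prob 0 s]_t F (a ord0 + t)%R)%E.
  apply: eq_integral => t _; rewrite /F -IH//; last exact: measurable_cons_curry.
  by congr gauss_exp; apply/funext => u; rewrite tshift_cons.
rewrite ge0_integral_normal_prob_shift//; apply: eq_integral => t _.
rewrite muleC /F -gauss_expZl ?expR_ge0//; last 2 first.
- by apply: emeasurable_funM => //; exact: measurable_cons_curry.
- by move=> u; rewrite mule_ge0.
congr gauss_exp; apply/funext => u.
rewrite muleCA -EFinM -expRD; congr (_ * (expR _)%:E)%E.
rewrite !big_ord_recl /=.
under [X in _ + X - _]eq_bigr do rewrite tnthS.
by rewrite tnth0 /a'; field.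
Qed.

(** A combination of independent centred normals is a centred normal scaled by the norm of [a]. The
    induction merges the tail into one Gaussian and adds the first coordinate by planar rotation;
    the constant [c] absorbs that coordinate. *)
Lemma gauss_exp_dot n (a : 'I_n -> R) (c : R) (phi : R -> \bar R) :
  measurable_fun setT phi -> (forall x, 0 <= phi x)%E ->
  gauss_exp s (fun t : n.-tuple R => phi (c + \sum_i a i * tnth t i)%R) =
  (\int[normal_prob 0 s]_z phi (c + Num.sqrt (\sum_i a i ^+ 2) * z)%R)%E.
Proof.
move=> mphi phi0; elim: n a c => [|n IH] a c.
  rewrite /= !big_ord0 sqrtr0 addr0.
  under eq_integral do rewrite mul0r addr0.
  by rewrite integral_cst// -[LHS]mule1; congr (_ * _)%E; apply/esym/probability_setT.
pose a' i := a (lift ord0 i).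
transitivity (\int[normal_prob 0 s]_x \int[normal_prob 0 s]_z
   phi (c + (a ord0 * x + Num.sqrt (\sum_i a' i ^+ 2) * z))%R)%E.
  apply: eq_integral => t _.
  under [RHS]eq_integral do rewrite addrA.
  rewrite -IH; congr gauss_exp; apply/funext => u.
  rewrite big_ord_recl /= addrA; congr (phi (_ + _)).
  by apply: eq_bigr => i _; rewrite tnthS.
have := @ge0_integral_normal_prob_lin2 R s (a ord0) (Num.sqrt (\sum_i a' i ^+ 2))
  (Num.sqrt (\sum_i a i ^+ 2)) (fun x => phi (c + x)%R) s0 (sqrtr_ge0 _).
apply => //.
  rewrite !sqr_sqrtr ?sumr_ge0// ?big_ord_recl// => i _; exact: sqr_ge0.
by apply: measurableT_comp mphi _; exact: measurable_funD.
Qed.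

End gauss_exp_linear.

(** * Neyman-Pearson bound *)

Lemma normal_pdf_scale {R : realType} (s x : R) : 0 < s ->
  s * normal_pdf 0 s (s * x) = normal_pdf 0 1 x.
Proof.
move=> sp; have s0 : s != 0 by rewrite gt_eqF.
rewrite (normal_pdfE _ s0) (normal_pdfE _ (oner_neq0 R)) mulrA.
have -> : s * normal_peak s = normal_peak 1.
  rewrite /normal_peak -mulrnAr sqrtrM ?sqr_ge0// sqrtr_sqr gtr0_norm// invfM mulrA.
  by rewrite divff// mul1r expr1n mul1r.
have -> // : normal_fun 0 s (s * x) = normal_fun 0 1 x.
rewrite /normal_fun !subr0; congr expR.
by rewrite -(mulr_natr (s ^+ 2)) -(mulr_natr (1 ^+ 2)) expr1n; field.
Qed.

Lemma ge0_integral_normal_prob_scale {R : realType} (s : R) (phi : R -> \bar R) :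
  0 < s -> measurable_fun setT phi -> (forall x, 0 <= phi x)%E ->
  (\int[normal_prob 0 s]_z phi z = \int[normal_prob 0 1]_z phi (s * z)%R)%E.
Proof.
move=> sp mphi phi0.
have s0 : s != 0 by rewrite gt_eqF.
have mr (u : R) : measurable_fun setT (fun x : R => (normal_pdf 0 u x)%:E).
  by apply/measurable_EFinP; exact: measurable_normal_pdf.
have ms : measurable_fun setT (fun z : R => phi (s * z)).
  by apply: measurableT_comp mphi _; exact: measurable_funM.
have mpr : measurable_fun setT (fun x => phi x * (normal_pdf 0 s x)%:E)%E.
  exact: emeasurable_funM.
have pr0 x : (0 <= phi x * (normal_pdf 0 s x)%:E)%E.
  by rewrite mule_ge0// lee_fin normal_pdf_ge0.
have phis0 z : (0 <= phi (s * z)%R)%E by [].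
rewrite [LHS](@ge0_integral_normal_prob R s phi mphi phi0).
rewrite [RHS](@ge0_integral_normal_prob R 1 _ ms phis0).
rewrite [LHS](@ge0_integral_affine R s 0 _ s0 mpr pr0).
have mr' : measurable_fun setT (fun x : R => (normal_pdf 0 s (s * x + 0))%:E).
  apply: (measurableT_comp (mr s)); apply: measurable_funD => //; exact: measurable_funM.
have mm : measurable_fun setT
    (fun x => phi (s * x + 0)%R * (normal_pdf 0 s (s * x + 0)%R)%:E)%E.
  by apply: emeasurable_funM => //; under eq_fun do rewrite addr0.
rewrite -ge0_integralZl;
  [|by []|exact: mm|by move=> x _; exact: pr0|by rewrite lee_fin].
apply: eq_integral => x _; rewrite addr0 muleCA -EFinM; congr (_ * _%:E)%E.
by rewrite gtr0_norm// normal_pdf_scale.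
Qed.

(** For [z] of law [N(0, s^2)], [a + b z] has law [N(a, (b s)^2)]. *)
Lemma integral_indic_le_Phi {R : realType} (s a b c : R) : 0 < s -> 0 < b ->
  (\int[normal_prob 0 s]_z (\1_[set u : R | u <= c] (a + b * z)%R)%:E =
   (Phi ((c - a) / (b * s)))%:E)%E.
Proof.
move=> s0 b0.
have mc (e : R) : measurable [set u : R | u <= e] by rewrite -set_itvNyc.
have mi : measurable_fun setT (fun u : R => (\1_[set u : R | u <= c] u)%:E : \bar R).
  by apply/measurable_EFinP; exact: measurable_indic.
have mb : measurable_fun setT
    (fun z => (\1_[set u : R | u <= c] (a + b * z)%R)%:E : \bar R).
  by apply: (measurableT_comp mi); apply: measurable_funD => //; exact: measurable_funM.
rewrite [LHS](@ge0_integral_normal_prob_scale R s _ s0 mb)//.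
rewrite Phi_fin -[X in normal_prob 0 1 X]setIT -integral_indic; [|by []|exact: mc].
apply: eq_integral => z _; congr _%:E; rewrite !indicE; congr (_%:R).
congr (nat_of_bool _); apply/idP/idP; rewrite !inE /= ler_pdivlMr ?mulr_gt0// lerBrDl;
  by rewrite (_ : b * (s * z) = z * (b * s)); last by ring.
Qed.

(* Neyman-Pearson: among the tests [f] of a given size under the centred
   Gaussian, the half-space [dot <= c] has the least power under the shift. *)
Lemma gauss_exp_shift_ge {R : realType} (s tau : R) n (a : 'I_n -> R)
    (f : n.-tuple R -> R) :
  0 < s -> measurable_fun setT f -> (forall t, 0 <= f t <= 1) ->
  ((Phi tau)%:E <= gauss_exp s (fun t => (f t)%:E))%E ->
  ((Phi (tau - Num.sqrt (\sum_i a i ^+ 2) / s))%:E <=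
    gauss_exp s (fun t => (f (tshift a t))%:E))%E.
Proof.
move=> sp mf f01 tauf.
have s0 : s != 0 by rewrite gt_eqF.
have f0 t : (0 <= (f t)%:E)%E by rewrite lee_fin; case/andP: (f01 t).
have mfE : measurable_fun setT (fun t => (f t)%:E) by exact/measurable_EFinP.
set r := Num.sqrt _.
have r0 : 0 <= r by exact: sqrtr_ge0.
have r2 : r ^+ 2 = \sum_i a i ^+ 2.
  by rewrite sqr_sqrtr// sumr_ge0// => i _; exact: sqr_ge0.
(* A zero shift is treated apart, since the half-space below is normalised by [r]. *)
have [rz|rn0] := eqVneq r 0.
  have a0 i : a i = 0.
    apply/eqP; rewrite -sqrf_eq0 eq_le sqr_ge0 andbT.
    have <- : r ^+ 2 = 0 by rewrite rz expr0n.
    by rewrite r2 (bigD1 i)//= lerDl sumr_ge0// => j _; exact: sqr_ge0.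
  rewrite rz mul0r subr0 (_ : (fun t => _) = (fun t => (f t)%:E))//.
  apply/funext => t; congr (f _)%:E; apply: eq_from_tnth => i.
  by rewrite tnth_mktuple a0 add0r.
have rp : 0 < r by rewrite lt_neqAle eq_sym rn0.
(* Under the centred Gaussian [dot] has standard deviation [s * r], so this threshold gives the
   half-space mass [Phi tau]. *)
pose c := tau * (s * r).
pose dot (t : n.-tuple R) := \sum_i a i * tnth t i.
pose h (u : R) : R := \1_[set u : R | u <= c] u.
pose L (t : n.-tuple R) := expR ((dot t - (\sum_i a i ^+ 2) / 2) / s ^+ 2).
(* The likelihood ratio on the boundary [dot t = c]. *)
pose lam := expR ((c - (\sum_i a i ^+ 2) / 2) / s ^+ 2).
have h0 u : (0 <= (h u)%:E)%E by rewrite lee_fin /h indicE.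
have mh : measurable_fun setT (fun u => (h u)%:E).
  apply/measurable_EFinP; apply: measurable_indic.
  by rewrite -set_itvNyc.
have mhd : measurable_fun setT (fun t => (h (dot t))%:E).
  by apply: measurableT_comp mh _; exact: measurable_dot.
have mL : measurable_fun setT (fun t => (L t)%:E) by exact: measurable_likelihood.
have L0 t : (0 <= (L t)%:E)%E by rewrite lee_fin expR_ge0.
have lam0 : 0 <= lam by exact: expR_ge0.
have lamE0 : (0 <= lam%:E)%E by rewrite lee_fin.
have Eh : gauss_exp s (fun t => (h (dot t))%:E) = (Phi tau)%:E.
  have := @gauss_exp_dot R s s0 n a 0 (fun u => (h u)%:E) mh h0.
  under eq_fun do rewrite add0r.
  move=> ->; rewrite integral_indic_le_Phi// subr0; congr (Phi _)%:E.
  by rewrite /c -/r; field; rewrite s0 rn0.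
(* The shift raises [dot] by [r ^+ 2], and [(c - r ^+ 2) / (r * s) = tau - r / s]. *)
have EhL : gauss_exp s (fun t => (h (dot t))%:E * (L t)%:E)%E
           = (Phi (tau - r / s))%:E.
  rewrite -(@gauss_exp_shift R s s0 n a (fun t => (h (dot t))%:E))//.
  have := @gauss_exp_dot R s s0 n a (r ^+ 2) (fun u => (h u)%:E) mh h0.
  rewrite integral_indic_le_Phi// => E.
  transitivity ((Phi ((c - r ^+ 2) / (r * s)))%:E); last first.
    by congr (Phi _)%:E; rewrite /c; field; rewrite s0 rn0.
  rewrite -E; congr gauss_exp; apply/funext => t; congr (h _)%:E.
  rewrite /dot r2 -big_split /=; apply: eq_bigr => i _.
  by rewrite tnth_mktuple mulrDr expr2.
(* This is [(f - h) * (L - lam) >= 0] written without subtraction: [h] is 1 exactly where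
   [L <= lam]. *)
have NP t : ((h (dot t))%:E * (L t)%:E + lam%:E * (f t)%:E <=
             (f t)%:E * (L t)%:E + lam%:E * (h (dot t))%:E)%E.
  rewrite -!EFinM -!EFinD lee_fin /h indicE.
  have /andP[ft0 ft1] := f01 t.
  case: (boolP (_ \in _)) => [/set_mem|/negP] /= H.
    have : L t <= lam.
      by rewrite ler_expR ler_pM2r ?invr_gt0 ?exprn_gt0// lerD2r.
    nra.
  have : lam <= L t.
    rewrite ler_expR ler_pM2r ?invr_gt0 ?exprn_gt0// lerD2r.
    by rewrite leNgt; apply/negP => lt; apply: H; rewrite inE /= ltW.
  by nra.
have mfL : measurable_fun setT (fun t => (f t)%:E * (L t)%:E)%E by exact: emeasurable_funM.
have mhL : measurable_fun setT (fun t => (h (dot t))%:E * (L t)%:E)%E.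
  exact: emeasurable_funM.
have mlf : measurable_fun setT (fun t => lam%:E * (f t)%:E)%E by exact: emeasurable_funM.
have mlh : measurable_fun setT (fun t => lam%:E * (h (dot t))%:E)%E.
  exact: emeasurable_funM.
have := @le_gauss_exp R s n _ _ (emeasurable_funD mhL mlf) (emeasurable_funD mfL mlh)
  (fun t => adde_ge0 (mule_ge0 (h0 _) (L0 _)) (mule_ge0 lamE0 (f0 _))) NP.
rewrite !gauss_expD//; try by move=> t; rewrite mule_ge0.
rewrite !gauss_expZl// EhL Eh -gauss_exp_shift//.
set G := gauss_exp s (fun t => (f t)%:E) in tauf *.
have G1 : (G <= 1)%E.
  rewrite -(@gauss_exp1 R s n); apply: le_gauss_exp => // t.
  by rewrite lee_fin; case/andP: (f01 t).
have Gfin : G \is a fin_num.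
  rewrite ge0_fin_numE ?gauss_exp_ge0//; exact: le_lt_trans G1 (ltry _).
move=> H.
(* Finiteness lets [lam * G] be cancelled, after [Phi tau <= G] has enlarged the right-hand side. *)
have lamG : (lam%:E * G \is a fin_num)%E by rewrite fin_numM.
rewrite -(leeD2rE _ _ lamG); apply: le_trans H _.
by rewrite leeD2l// lee_wpmul2l.
Qed.

(** * Smoothed classifiers *)

Lemma sum_sqr_mxvec {R : realType} (N : nat) (d : 'M[R]_(N, 3)) :
  \sum_l mxvec d 0 l ^+ 2 = \sum_i \sum_j d i j ^+ 2.
Proof.
rewrite (reindex _ (curry_mxvec_bij _ _)) pair_bigA /=.
by apply: eq_bigr => -[i j] _; rewrite /= mxvecE.
Qed.

(** Moving the cloud becomes shifting the noise, the form to which the Neyman-Pearson bound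
    applies. *)
Lemma tuple_to_cloud_shift {R : realType} (N : nat) (x d : 'M[R]_(N, 3)) t :
  x + tuple_to_cloud (tshift (fun l => mxvec d 0 l) t) =
  (x + d) + tuple_to_cloud t.
Proof.
rewrite -addrA; congr (_ + _); rewrite -{2}[d]mxvecK /tuple_to_cloud -raddfD.
by congr vec_mx; apply/rowP => l; rewrite !mxE tnth_mktuple.
Qed.

Lemma cloud_normB {R : realType} (N : nat) (x y : 'M[R]_(N, 3)) :
  cloud_norm (x - y) = cloud_norm (y - x).
Proof.
rewrite -opprB /cloud_norm; congr Num.sqrt; apply: eq_bigr => i _; apply: eq_bigr => j _.
by rewrite mxE sqrrN.
Qed.

Section smoothed_classifier.
Context {R : realType} (N C : nat) (sigma : R) (P : 'M[R]_(N, 3) -> 'I_C -> R).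
Hypotheses (sigma0 : 0 < sigma) (HP : is_base_classifier P).
Implicit Types (x : 'M[R]_(N, 3)) (y : 'I_C).

Lemma base_classifier01 x y : 0 <= P x y <= 1.
Proof.
case: HP => _ [P0 P1]; rewrite P0 /= -(P1 x) (bigD1 y)//= lerDl.
by rewrite sumr_ge0.
Qed.

Lemma measurable_base_classifier x y :
  measurable_fun setT (fun t => P (x + tuple_to_cloud t) y).
Proof.
case: HP => mP _.
have := measurableT_comp (mP y) (measurable_tshift _ (fun l => mxvec x 0 l)).
congr (measurable_fun _ _); apply/funext => t /=.
by rewrite -[X in P X]add0r tuple_to_cloud_shift add0r.
Qed.

(** The expectation lies between 0 and 1, so [fine] loses nothing. *)
Lemma smoothedE x y : (smoothed sigma P x y)%:E =
  gauss_exp sigma (fun t : (N * 3).-tuple R => (P (x + tuple_to_cloud t) y)%:E).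
Proof.
rewrite /smoothed fineK// ge0_fin_numE; last first.
  by apply: gauss_exp_ge0 => t; rewrite lee_fin; case/andP: (base_classifier01 (x + tuple_to_cloud t) y).
apply: (@le_lt_trans _ _ 1%E); last exact: ltry.
rewrite -(@gauss_exp1 R sigma (N * 3)); apply: le_gauss_exp => //.
- by apply/measurable_EFinP; exact: measurable_base_classifier.
- by move=> t; rewrite lee_fin; case/andP: (base_classifier01 (x + tuple_to_cloud t) y).
- by move=> t; rewrite lee_fin; case/andP: (base_classifier01 (x + tuple_to_cloud t) y).
Qed.

(** The Neyman-Pearson bound for the shift [x' - x]; monotonicity of [Phi] replaces its norm by
    [r]. *)
Lemma smoothed_shift_ge x x' y (tau r : R) :
  cloud_norm (x' - x) <= r ->
  Phi tau <= smoothed sigma P x y ->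
  Phi (tau - r / sigma) <= smoothed sigma P x' y.
Proof.
move=> dr; rewrite -lee_fin smoothedE => H.
have := @gauss_exp_shift_ge R sigma tau (N * 3) (fun l => mxvec (x' - x) 0 l)
  _ sigma0 (measurable_base_classifier x y)
  (fun t => base_classifier01 (x + tuple_to_cloud t) y) H.
under [X in (_ <= gauss_exp _ X)%E]eq_fun do
  rewrite tuple_to_cloud_shift (addrC x) subrK.
rewrite -smoothedE lee_fin sum_sqr_mxvec -/(cloud_norm _).
apply: le_trans.
have : tau - r / sigma <= tau - cloud_norm (x' - x) / sigma.
  by rewrite lerD2l lerN2 ler_pM2r// invr_gt0.
by rewrite le_eqVlt => /orP[/eqP->//|/Phi_lt/ltW].
Qed.

End smoothed_classifier.

(** * Transfer of the margin from the net to every rotation *)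

Theorem mainTheorem3 (R : realType) (N C M : nat)
  (x : 'M[R]_(N, 3)) (sigma : R) (P : 'M[R]_(N, 3) -> 'I_C -> R)
  (Rad eta delta : R)
  (ks : 'I_M -> 'rV[R]_3) (ths : 'I_M -> R) (yA : 'I_C) (pA pB : 'I_M -> R) :
  0 < sigma ->
  is_base_classifier P ->
  0 < Rad -> Rad <= pi ->
  0 <= eta -> 0 <= delta ->
  delta ^+ 2 / 4 + eta ^+ 2 * Rad ^+ 2 / 8 <= 1 ->
  (forall j, on_S2 (ks j) /\ 0 <= ths j <= Rad) ->
  (forall k theta, on_S2 k -> 0 <= theta <= Rad ->
     exists j, vangle k (ks j) <= eta /\ `|theta - ths j| <= delta) ->
  (forall j, 0 < pA j < 1 /\ 0 < pB j < 1) ->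
  (forall j, smoothed sigma P (phiR x (ks j) (ths j)) yA >= pA j) ->
  (forall j, pA j > pB j) ->
  (forall j y, y != yA -> smoothed sigma P (phiR x (ks j) (ths j)) y <= pB j) ->
  (forall j, sigma / 2 * (Phi_inv (pA j) - Phi_inv (pB j)) >
             pi * Num.sqrt (delta ^+ 2 / 4 + eta ^+ 2 * Rad ^+ 2 / 8) * cloud_norm x) ->
  forall k theta, on_S2 k -> 0 <= theta <= Rad ->
  forall y, y != yA ->
    smoothed sigma P (phiR x k theta) yA > smoothed sigma P (phiR x k theta) y.
Proof.
(* Used with [u = r / sigma]: the margin pays for two shifts, one for each class. *)
have margin (a b u : R) : u < (a - b) / 2 -> b < a + - (u + u) by move=> h; lra.
move=> sigma0 HP _ _ _ _ _ Hz Hcover Hp HA _ HB Hmargin k theta kS thR y yyA.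
have [j [kj tj]] := Hcover k theta kS thR.
have [kjS tjR] := Hz j; have [pA01 pB01] := Hp j.
set z := phiR x k theta; set zj := phiR x (ks j) (ths j).
set r := pi * _ * cloud_norm x in Hmargin.
have dist : cloud_norm (z - zj) <= r by exact: phiR_dist.
have dist' : cloud_norm (zj - z) <= r by rewrite cloud_normB.
rewrite ltNge; apply/negP => le_yA_y.
(* From the net point [zj] to [z], for class [yA]. *)
have qA : Phi (Phi_inv (pA j) - r / sigma) <= smoothed sigma P z yA.
  by apply: (smoothed_shift_ge N C sigma P sigma0 HP zj) => //; rewrite Phi_invK.
(* Back from [z] to [zj], for class [y], whose score at [z] is assumed at least that of [yA]. *)
have qy : Phi (Phi_inv (pA j) - r / sigma - r / sigma) <= smoothed sigma P zj y.
  apply: (smoothed_shift_ge N C sigma P sigma0 HP z) => //.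
  exact: le_trans qA le_yA_y.
(* Since [pB j = Phi (Phi_inv (pB j))], strict monotonicity of [Phi] reduces the contradiction to
   the margin condition. *)
have := le_trans qy (HB j y yyA); rewrite -[pB j](Phi_invK _ pB01) leNgt => /negP; apply.
apply: Phi_lt; rewrite -addrA -opprD; apply: margin.
rewrite ltr_pdivrMr// (lt_le_trans (Hmargin j))// le_eqVlt.
by apply/orP; left; apply/eqP; field.
Qed.
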